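(* Let $G$ be a finite $3$-edge-connected graph and let $M$ be the cographic matroid of $G$. Then $M$ has a unique (inclusion-)minimal tropical basis, and it consists of the edge cuts that split $G$ into two $2$-edge-connected subgraphs.
   Context: A graph is $k$-edge-connected if it remains connected after removing any $k-1$ edges (so it is connected after removing any set of at most $k-1$ edges). A bridge of a connected graph is an edge whose removal disconnects the graph; a connected graph is $2$-edge-connected if and only if it contains no bridge (in particular a single vertex is $2$-edge-connected). The cographic matroid of a connected graph $G$ has the edge set of $G$ as ground set, and its circuits are the inclusion-minimal edge cuts, i.e. the inclusion-minimal sets of edges whose removal disconnects $G$. Such an edge cut $C$ consists of all edges between the two parts of a partition of the vertex set into two nonempty parts whose induced subgraphs $U$ and $V$ are connected; one says $C$ splits $G$ into the subgraphs $U$ and $V$. For a matroid with ground set $[n]$ and collection of circuits $\mathcal{C}$: let $\mathbb{T} = \mathbb{R} \cup \{\infty\}$ and $\mathbb{TP}^{n-1} = (\mathbb{T}^n \setminus \{(\infty,\dots,\infty)\})/\mathbb{R}(1,\dots,1)$. For a circuit $C$ let $\mathcal{T}(C)$ be the set of points $x \in \mathbb{TP}^{n-1}$ such that the minimum of $\{x_i : i \in C\}$ is attained at least twice, i.e. by at least two distinct indices $i \in C$ (this includes the case where all $x_i$, $i\in C$, are $\infty$). For $\mathcal{B} \subset \mathcal{C}$ let $\mathcal{T}(\mathcal{B}) = \bigcap_{C \in \mathcal{B}} \mathcal{T}(C)$. A subset $\mathcal{B} \subset \mathcal{C}$ is a tropical basis if $\mathcal{T}(\mathcal{B}) = \mathcal{T}(\mathcal{C})$.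 *)

(* Defs.v *)
(* Plain MathComp for graphs and matroids; MathComp-Analysis for the reals,
   the extended reals and sets of tropical points. *)
From mathcomp Require Import all_boot all_order all_algebra.

Set Implicit Arguments.
Unset Strict Implicit.
Unset Printing Implicit Defensive.

Local Open Scope set_scope.

(** * Graphs *)

(* Finite graphs with parallel edges and loops allowed: [ends e] is the set of
   endpoints of [e], a singleton when [e] is a loop. *)
Record graph := Graph {
  vertex : finType;
  edge : finType;
  ends : edge -> {set vertex};
  card_ends : forall e, 0 < #|ends e| <= 2
}.

(* A subgraph of [G] is given by a vertex set [W] and an edge set [F]; edges of
   [F] with an endpoint outside [W] are ignored. *)
Definition adjacent (G : graph) (W : {set vertex G}) (F : {set edge G}) :
    rel (vertex G) :=
  fun x y => [&& x \in W, y \in W & [exists e in F, ends e == [set x; y]]].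

Definition subgraph_connected (G : graph) (W : {set vertex G})
    (F : {set edge G}) : bool :=
  (W != set0) && [forall x in W, forall y in W, connect (adjacent W F) x y].

Definition subgraph_edge_connected (k : nat) (G : graph) (W : {set vertex G})
    (F : {set edge G}) : bool :=
  [forall S : {set edge G}, (#|S| < k) ==> subgraph_connected W (F :\: S)].

Definition induced_edges (G : graph) (W : {set vertex G}) : {set edge G} :=
  [set e : edge G | ends e \subset W].

Definition edges_between (G : graph) (U V : {set vertex G}) : {set edge G} :=
  [set e : edge G | [exists u in U, exists v in V, ends e == [set u; v]]].

Definition graph_connected (G : graph) : bool :=
  subgraph_connected [set: vertex G] [set: edge G].

Definition edge_connected (k : nat) (G : graph) : bool :=
  subgraph_edge_connected k [set: vertex G] [set: edge G].

Definition disconnecting (G : graph) (C : {set edge G}) : bool :=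
  ~~ subgraph_connected [set: vertex G] ([set: edge G] :\: C).

Definition minimal_edge_cut (G : graph) (C : {set edge G}) : bool :=
  minset (@disconnecting G) C.

Definition splits (G : graph) (C : {set edge G}) (U V : {set vertex G}) :
    bool :=
  [&& V == ~: U, subgraph_connected U (induced_edges U),
      subgraph_connected V (induced_edges V) & C == edges_between U V].

(** * Matroids, presented by their circuits *)

Record matroid (E : finType) := Matroid {
  circuits : {set {set E}};
  circuit_neq0 : set0 \notin circuits;
  circuit_incomparable : forall C1 C2 : {set E},
    C1 \in circuits -> C2 \in circuits -> C1 \subset C2 -> C1 = C2;
  circuit_elimination : forall (C1 C2 : {set E}) (e : E),
    C1 \in circuits -> C2 \in circuits -> C1 != C2 -> e \in C1 :&: C2 ->
    exists2 C3 : {set E}, C3 \in circuits & C3 \subset (C1 :|: C2) :\ e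
}.

Lemma endsP (G : graph) (e : edge G) : exists u v, ends e = [set u; v].
Proof.
have /andP[e_gt0] := card_ends e; rewrite leq_eqVlt => /orP[/cards2P|].
  by case=> u [v [_ ->]]; exists u, v.
rewrite ltnS => e_le1; have /cards1P[u ->] : #|ends e| == 1.
  by rewrite eqn_leq e_le1.
by exists u, u; rewrite setUid.
Qed.

Lemma in_cut (G : graph) (e : edge G) (u v : vertex G) (S : {set vertex G}) :
  ends e = [set u; v] ->
  (e \in edges_between S (~: S)) = (u \in S) (+) (v \in S).
Proof.
move=> euv; rewrite inE; apply/existsP/idP => [[a /andP[aS /existsP[b]]]|].
  rewrite inE euv => /andP[bS /eqP uvab].
  have: (a \in [set u; v]) && (b \in [set u; v]).
    by rewrite uvab !inE !eqxx orbT.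
  have: (u \in [set a; b]) && (v \in [set a; b]).
    by rewrite -uvab !inE !eqxx orbT.
  rewrite !inE => /andP[/orP[]/eqP-> /orP[]/eqP->];
    rewrite ?aS ?(negbTE bS) //= ?orbb => /andP[/eqP ab /eqP ba];
    by move: bS; rewrite -?ab ?ba ?aS.
case uS: (u \in S); case vS: (v \in S) => //= _.
  by exists u; rewrite uS; apply/existsP; exists v; rewrite inE vS euv eqxx.
by exists v; rewrite vS; apply/existsP; exists u; rewrite inE uS euv setUC eqxx.
Qed.

Lemma disconnecting_cut (G : graph) (D : {set edge G}) (S : {set vertex G})
    (x y : vertex G) :
  x \in S -> y \notin S -> edges_between S (~: S) \subset D -> disconnecting D.
Proof.
move=> xS yS /subsetP SD; apply/negP => /andP[_ /forallP/(_ x)].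
rewrite inE => /forallP/(_ y); rewrite inE /= => xy.
have/closed_connect/(_ _ _ xy) : closed (adjacent setT (setT :\: D)) S.
  move=> a b /and3P[_ _ /existsP[e /andP[]]].
  rewrite !inE andbT => eD /eqP eab; apply/eqP/negPn/negP => Sab.
  by case/negP: eD; apply: SD; rewrite (in_cut _ eab); case: (a \in S) Sab;
    case: (b \in S).
by rewrite xS (negbTE yS).
Qed.

Lemma minimal_edge_cutP (G : graph) (C : {set edge G}) :
  graph_connected G -> minimal_edge_cut C ->
  exists S : {set vertex G}, C = edges_between S (~: S).
Proof.
move=> /andP[V0 _] /minsetP[]; rewrite {1}/disconnecting /subgraph_connected V0.
case/forallPn=> x; rewrite inE => /forallPn[y]; rewrite inE /= => xy minC.
pose S := [set z | connect (adjacent setT (setT :\: C)) x z].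
have SC : edges_between S (~: S) \subset C.
  apply/subsetP => e; rewrite inE.
  case/existsP=> u /andP[uS /existsP[v /andP[]]].
  rewrite inE => vS euv; apply/negPn/negP => eC; case/negP: vS.
  move: uS; rewrite !inE => xu; apply: connect_trans xu (connect1 _).
  by rewrite /adjacent !inE; apply/existsP; exists e; rewrite !inE eC.
exists S; apply/esym/minC => //; apply: (@disconnecting_cut _ _ S x y) => //.
  by rewrite inE connect0.
by rewrite inE.
Qed.

Section Cographic.
Context (G : graph) (hG : graph_connected G).

Let bonds := [set C : {set edge G} | minimal_edge_cut C].

Fact bond_neq0 : set0 \notin bonds.
Proof.
rewrite inE; apply/negP => /minsetp.
by rewrite /disconnecting setD0; apply/negP/negPn.
Qed.

Fact bond_incomparable (C1 C2 : {set edge G}) :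
  C1 \in bonds -> C2 \in bonds -> C1 \subset C2 -> C1 = C2.
Proof. by rewrite !inE => /minsetp d1 /minsetinf m2; apply: m2. Qed.

Fact bond_elimination (C1 C2 : {set edge G}) (e : edge G) :
  C1 \in bonds -> C2 \in bonds -> C1 != C2 -> e \in C1 :&: C2 ->
  exists2 C3 : {set edge G}, C3 \in bonds & C3 \subset (C1 :|: C2) :\ e.
Proof.
rewrite !inE => /(minimal_edge_cutP hG)[S1 ->] /(minimal_edge_cutP hG)[S2 ->].
move=> neq12 /andP[e1 e2].
pose S := [set z | (z \in S1) (+) (z \in S2)].
have cutS f : (f \in edges_between S (~: S)) =
    (f \in edges_between S1 (~: S1)) (+) (f \in edges_between S2 (~: S2)).
  have [u [v fuv]] := endsP f; rewrite !(in_cut _ fuv) !inE.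
  by do 4 case: (_ \in _).
have [f fS] : exists f, f \in edges_between S (~: S).
  apply/existsP; apply: contraNT neq12 => /existsPn no; apply/eqP/setP => f.
  by apply/eqP; move: (no f); rewrite cutS; do 2 case: (_ \in _).
have [u [v fuv]] := endsP f.
suff: disconnecting ((edges_between S1 (~: S1) :|: edges_between S2 (~: S2)) :\ e).
  by case/minset_exists=> C3 mC3 sC3; exists C3 => //; rewrite inE.
have sub : edges_between S (~: S) \subset
    (edges_between S1 (~: S1) :|: edges_between S2 (~: S2)) :\ e.
  apply/subsetP => g; rewrite cutS in_setD1 in_setU.
  case: (g =P e) => [->|_]; first by rewrite e1 e2.
  by do 2 case: (_ \in _).
move: fS; rewrite (in_cut _ fuv); case uS: (u \in S); case vS: (v \in S) => // _.
  by apply: (@disconnecting_cut _ _ S u v); rewrite ?uS ?vS.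
by apply: (@disconnecting_cut _ _ S v u); rewrite ?uS ?vS.
Qed.

Definition cographic_matroid : matroid (edge G) :=
  Matroid bond_neq0 bond_incomparable bond_elimination.

End Cographic.

Lemma edge_connected_connected (k : nat) (G : graph) :
  0 < k -> edge_connected k G -> graph_connected G.
Proof.
by move=> k0 /forallP/(_ set0); rewrite cards0 k0 setD0.
Qed.

Definition cuts_into_2_edge_connected (G : graph) : {set {set edge G}} :=
  [set C : {set edge G} | minimal_edge_cut C &&
    [exists U : {set vertex G}, exists V : {set vertex G},
      [&& splits C U V, subgraph_edge_connected 2 U (induced_edges U)
        & subgraph_edge_connected 2 V (induced_edges V)]]].

(** * Tropical bases *)

From mathcomp Require Import generic_quotient.
From mathcomp Require Import boolp classical_sets reals constructive_ereal.

Local Open Scope classical_set_scope.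
Local Open Scope ereal_scope.
Local Open Scope quotient_scope.

(* [\bar R] without [-oo] is R U {oo}; its order and addition are the tropical
   ones. *)
Definition tropical_vector (R : realType) (E : finType) :=
  {x : {ffun E -> \bar R} | [forall e, x e != -oo] && [exists e, x e != +oo]}.

Definition tropical_equiv (R : realType) (E : finType) :
    rel (tropical_vector R E) :=
  fun x y => `[< exists c : R, forall e, val y e = val x e + c%:E >].

Lemma tropical_equiv_refl (R : realType) (E : finType) :
  reflexive (@tropical_equiv R E).
Proof. by move=> x; apply/asboolP; exists 0%R => e; rewrite adde0. Qed.

Lemma tropical_equiv_sym (R : realType) (E : finType) :
  symmetric (@tropical_equiv R E).
Proof.
suff imp x y : @tropical_equiv R E x y -> tropical_equiv y x.
  by move=> x y; apply/idP/idP; apply: imp.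
by case/asboolP=> c yx; apply/asboolP; exists (- c)%R => e; rewrite yx addeK.
Qed.

Lemma tropical_equiv_trans (R : realType) (E : finType) :
  transitive (@tropical_equiv R E).
Proof.
move=> y x z /asboolP[c yx] /asboolP[d zy]; apply/asboolP.
by exists (c + d)%R => e; rewrite zy yx EFinD addeA.
Qed.

Canonical tropical_equiv_rel (R : realType) (E : finType) :=
  EquivRel (@tropical_equiv R E) (@tropical_equiv_refl R E)
    (@tropical_equiv_sym R E) (@tropical_equiv_trans R E).

Definition tropical_projective_space (R : realType) (E : finType) :=
  {eq_quot @tropical_equiv R E}.

Definition min_attained_twice (R : realType) (E : finType) (C : {set E})
    (x : E -> \bar R) : Prop :=
  exists i j : E, [/\ i \in C, j \in C, i != j, x i = x j
    & forall k, k \in C -> x i <= x k].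

Definition tropical_hyperplane (R : realType) (E : finType) (C : {set E}) :
    set (tropical_projective_space R E) :=
  [set p | min_attained_twice C (val (repr p : tropical_vector R E))].

(* The choice of representative is immaterial. *)
Lemma tropical_hyperplane_pi (R : realType) (E : finType) (C : {set E})
    (x : tropical_vector R E) :
  tropical_hyperplane C (\pi_(tropical_projective_space R E) x) <->
  min_attained_twice C (val x).
Proof.
have transl (y z : tropical_vector R E) : tropical_equiv y z ->
    min_attained_twice C (val y) -> min_attained_twice C (val z).
  case/asboolP=> c zy [i [j [iC jC ij yij yi]]]; exists i, j.
  by split=> // [|k kC]; rewrite !zy ?yij // -yij leeD2r // yi.
have rx : tropical_equiv x (repr (\pi_(tropical_projective_space R E) x)).
  by apply/eqmodP; rewrite reprK.
by split; apply: transl; rewrite // tropical_equiv_sym.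
Qed.

Definition tropical_prevariety (R : realType) (E : finType)
    (B : {set {set E}}) : set (tropical_projective_space R E) :=
  \bigcap_(C in [set C : {set E} | C \in B]) @tropical_hyperplane R E C.

Definition tropical_basis (R : realType) (E : finType) (M : matroid E)
    (B : {set {set E}}) : Prop :=
  B \subset circuits M /\
  tropical_prevariety B = tropical_prevariety (circuits M)
    :> set (tropical_projective_space R E).

Definition minimal_tropical_basis (R : realType) (E : finType) (M : matroid E)
    (B : {set {set E}}) : Prop :=
  tropical_basis R M B /\
  forall B' : {set {set E}}, tropical_basis R M B' -> B' \subset B -> B' = B.

(* Main.v *)
Require Import Defs.
From mathcomp Require Import boolp classical_sets reals constructive_ereal.
From mathcomp Require Import all_boot all_order zify.

Set Implicit Arguments.
Unset Strict Implicit.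
Unset Printing Implicit Defensive.

Import Order.TTheory.

(** Write [cut S] for the set of edges leaving a vertex set [S], and call a cut
    violated at a tropical point [x] when the minimum of [x] on it is attained
    only once; [x] lies on the tropical hyperplane of a bond exactly when the
    bond is not violated.  The theorem follows from two facts.

    The cuts into two 2-edge-connected parts form a tropical basis
    ([strict_min_cut_reduction]).  If some bond is violated at [x], choose a
    violated cut [cut S] with as few edges as possible.  If [S] were not
    2-edge-connected, it would be the disjoint union of nonempty sets [S1] and
    [S2] with at most one edge [f] between them.  Then [cut S] is the symmetric
    difference of [cut S1] and [cut S2], which share at most the edge [f].  Say
    that the minimum over [cut S] is attained at an edge [e] of [cut S1].  If
    [f] is absent or [x f > x e], then [cut S1] is violated at [e]; otherwise
    [x f <= x e] is smaller than all the other values on [cut S2], and [cut S2]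
    is violated at [f].  Either way the new cut is smaller than [cut S], because
    3-edge-connectedness provides at least two edges of the other cut besides
    [f].  This contradicts the choice of [S].  So [S], and by symmetry its
    complement, is 2-edge-connected, and then [cut S] is a bond.

    Every tropical basis contains each such cut [C]
    ([cut_into_2_edge_connected_essential]).  Fix an edge [e0] of [C] and give
    the edges of [C] other than [e0] the value 1 and all other edges the value
    0.  Then [C] is violated at [e0].  A bond other than [C] is not contained in
    [C], so it crosses one of the two parts; a 2-edge-connected part is crossed
    at least twice, always by edges of value 0.  Hence [C] is the only bond
    violated at this point.

    It follows that these cuts form the least tropical basis, which is therefore
    the only minimal one. *)

(** * Strict minima on finite sets *)

Definition has_strict_min d (T : orderType d) (E : finType) (x : E -> T)
    (C : {set E}) : bool :=
  [exists e in C, [forall k in C :\ e, (x e < x k)%O]].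

Lemma has_strict_minP d (T : orderType d) (E : finType) (x : E -> T)
    (C : {set E}) :
  reflect (exists2 e, e \in C & forall k, k \in C -> k != e -> (x e < x k)%O)
    (has_strict_min x C).
Proof.
apply: (iffP exists_inP) => -[e eC minE]; exists e => //.
  by move=> k kC ke; apply: (forall_inP minE); rewrite !inE ke.
by apply/forall_inP => k /setD1P[ke kC]; apply: minE.
Qed.

(** [A] and [B] share at most one element [f].  If [x f <= x e], then [x f] is
    below every other value on [B], so [f] is a strict minimum of [B]; otherwise
    [e] is still the strict minimum when [f] is added to [A :\: B].  Each of [A]
    and [B] keeps at least two elements outside the other one, while [f]
    contributes at most one, so both are smaller than the symmetric
    difference. *)
Lemma has_strict_min_symdiff_left d (T : orderType d) (E : finType)
    (x : E -> T) (A B : {set E}) (e : E) :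
  2 < #|A| -> 2 < #|B| -> #|A :&: B| <= 1 -> e \in A :\: B ->
  (forall k, k \in (A :\: B) :|: (B :\: A) -> k != e -> (x e < x k)%O) ->
  exists2 D, D \in [:: A; B] &
    has_strict_min x D && (#|D| < #|(A :\: B) :|: (B :\: A)|).
Proof.
move=> A3 B3 AB1 eAB min_e.
have cardU : #|(A :\: B) :|: (B :\: A)| = #|A :\: B| + #|B :\: A|.
  rewrite cardsU (_ : _ :&: _ = set0) ?cards0 ?subn0 //.
  by apply/setP => k; rewrite !inE; do 2 case: (_ \in _).
have cardA := cardsID B A; have := cardsID A B; rewrite setIC => cardB.
have ltA : #|A| < #|(A :\: B) :|: (B :\: A)| by lia.
have ltB : #|B| < #|(A :\: B) :|: (B :\: A)| by lia.
case: (boolP [exists f in A :&: B, (x f <= x e)%O]) => [|low].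
  case/exists_inP=> f fAB xf; exists B; first by rewrite !inE eqxx orbT.
  rewrite ltB andbT; apply/has_strict_minP; exists f.
    by case/setIP: fAB.
  move=> k kB kf; have kA : k \notin A.
    apply: contra kf => kA; apply/eqP/(card_le1_eqP AB1) => //.
    by rewrite inE kA.
  apply: le_lt_trans xf (min_e k _ _); first by rewrite !inE kA kB orbT.
  by apply: contraNneq kA => ->; case/setDP: eAB.
exists A; first by rewrite !inE eqxx.
rewrite ltA andbT; apply/has_strict_minP; exists e; first by case/setDP: eAB.
move=> k kA ke; case kB: (k \in B); last by apply: min_e; rewrite // !inE kA kB.
rewrite ltNge; apply: contra low => xk.
by apply/exists_inP; exists k => //; rewrite inE kA kB.
Qed.

Lemma has_strict_min_symdiff d (T : orderType d) (E : finType)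
    (x : E -> T) (A B : {set E}) :
  2 < #|A| -> 2 < #|B| -> #|A :&: B| <= 1 ->
  has_strict_min x ((A :\: B) :|: (B :\: A)) ->
  exists2 D, D \in [:: A; B] &
    has_strict_min x D && (#|D| < #|(A :\: B) :|: (B :\: A)|).
Proof.
move=> A3 B3 AB1 /has_strict_minP[e /setUP[eAB|eBA] min_e].
  exact: has_strict_min_symdiff_left min_e.
have [||||k|D] := @has_strict_min_symdiff_left _ _ _ x B A e => //.
- by rewrite setIC.
- by rewrite setUC; apply: min_e.
- by rewrite !inE orbC setUC => DAB minD; exists D; rewrite // !inE.
Qed.

(** * Cuts and connectivity *)

Notation cut S := (edges_between S (~: S)).

Section Cuts.
Variable G : graph.
Implicit Types (S U W : {set vertex G}) (F : {set edge G}).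

Lemma cutC S : cut (~: S) = cut S.
Proof.
apply/setP => e; have [u [v euv]] := endsP e.
by rewrite !(in_cut _ euv) !inE; do 2 case: (_ \in _).
Qed.

(** [in_cut] presents membership as an exclusive or, which is symmetric; here
    the endpoints are oriented. *)
Lemma cut_ends S e : e \in cut S ->
  exists u v, [/\ ends e = [set u; v], u \in S & v \notin S].
Proof.
have [u [v euv]] := endsP e; rewrite (in_cut _ euv).
case uS: (u \in S); case vS: (v \in S) => // _.
  by exists u, v; rewrite uS vS.
by exists v, u; rewrite uS vS setUC.
Qed.

Lemma subgraph_connected_cross W F S u v :
  subgraph_connected W F -> u \in W -> v \in W -> u \in S -> v \notin S ->
  exists2 e, e \in F & e \in cut S.
Proof.
case/andP=> _ /forall_inP conW uW vW uS vS; apply/exists_inP.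
apply: contraNT vS => /exists_inPn no.
have /forall_inP/(_ v vW)/closed_connect <- // := conW u uW.
move=> a b /and3P[_ _ /exists_inP[e eF /eqP eab]].
by have := no e eF; rewrite (in_cut _ eab); do 2 case: (_ \in _).
Qed.

(** The separating set is a connected component of the subgraph. *)
Lemma not_subgraph_connected_separation W F :
  W != set0 -> ~~ subgraph_connected W F ->
  exists S, [/\ S \subset W, S != set0, W :\: S != set0 &
    forall e, e \in F -> ends e \subset W -> e \notin cut S].
Proof.
rewrite /subgraph_connected => -> /forall_inPn[x xW /forall_inPn[y yW xy]].
exists [set z in W | connect (adjacent W F) x z]; split.
- by apply/subsetP => z; rewrite inE => /andP[].
- by apply/set0Pn; exists x; rewrite inE xW connect0.
- by apply/set0Pn; exists y; rewrite !inE yW (negbTE xy).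
move=> e eF eW; apply/negP => /cut_ends[u [v [euv]]].
have /andP[uW vW] : (u \in W) && (v \in W).
  by rewrite -!sub1set -subUset -euv.
rewrite !inE uW vW => xu /negP[]; apply: connect_trans xu (connect1 _).
by rewrite /adjacent uW vW; apply/exists_inP; exists e; rewrite ?euv.
Qed.

Lemma edge_connected_cut k S :
  edge_connected k G -> S != set0 -> ~: S != set0 -> k <= #|cut S|.
Proof.
move=> conG /set0Pn[x xS] /set0Pn[y]; rewrite inE => yS.
rewrite leqNgt; apply/negP => lt_k.
have /forall_inP/(_ (cut S) lt_k) con := conG.
have [e] := subgraph_connected_cross con (in_setT x) (in_setT y) xS yS.
by rewrite inE => /andP[/negP].
Qed.

Lemma induced_edges_cut U e : e \in induced_edges U -> e \notin cut U.
Proof.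
rewrite inE => eU; apply/negP => /cut_ends[u [v [euv _ /negP[]]]].
by apply: (subsetP eU); rewrite euv !inE eqxx orbT.
Qed.

Lemma edge_trichotomy U e :
  [\/ e \in cut U, e \in induced_edges U | e \in induced_edges (~: U)].
Proof.
have [u [v euv]] := endsP e; rewrite (in_cut _ euv) 2!inE euv !subUset !sub1set.
rewrite !inE; case: (u \in U); case: (v \in U);
  by [constructor 1 | constructor 2 | constructor 3].
Qed.

(** A cut inside [cut U] separates no two vertices of [U] and no two of its
    complement, so if it is nonempty it can only be [cut U] itself. *)
Lemma minimal_edge_cut_of_connected U :
  graph_connected G -> subgraph_connected U (induced_edges U) ->
  subgraph_connected (~: U) (induced_edges (~: U)) -> minimal_edge_cut (cut U).
Proof.
move=> conG conU conV.
have /set0Pn[x xU] : U != set0 by case/andP: conU.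
have /set0Pn[y] : ~: U != set0 by case/andP: conV.
rewrite inE => yU.
apply/minsetP; split=> [|D disD sDU].
  exact: disconnecting_cut xU yU (subxx _).
have [C minC sCD] := minset_exists disD.
have [S defC] := minimal_edge_cutP conG minC.
have sSU : cut S \subset cut U by rewrite -defC (subset_trans sCD).
have sameW W a b : W = U \/ W = ~: U ->
    subgraph_connected W (induced_edges W) -> a \in W -> b \in W -> a \in S -> b \in S.
  move=> WU conW aW bW aS; apply/negPn/negP => bS.
  have [e eW /(subsetP sSU)] := subgraph_connected_cross conW aW bW aS bS.
  apply/negP; case: WU eW => -> /induced_edges_cut //.
  by rewrite cutC.
have [e eS] : exists e, e \in cut S.
  apply/set0Pn; rewrite -defC; apply: contraTneq minC => ->.
  by have := bond_neq0 conG; rewrite inE.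
have [a [b [eab aS bS]]] := cut_ends eS.
apply/eqP; rewrite eqEsubset sDU (subset_trans _ sCD) // defC.
apply/subsetP => f; have [u [v fuv]] := endsP f.
rewrite (in_cut _ fuv) (in_cut _ fuv).
(* As [e] joins [U] to its complement, one of these two sets lies in [S] and
   the other one is disjoint from [S]. *)
have abU : (a \in U) (+) (b \in U).
  by rewrite -(in_cut _ eab) (subsetP sSU).
have inS z : (z \in S) = (z \in U) (+) (a \notin U).
  have sU c d := @sameW U c d (or_introl erefl) conU.
  have sV c d := @sameW (~: U) c d (or_intror erefl) conV.
  move: (sU a z) (sU z b) (sV a z) (sV z b); rewrite !inE.
  move: abU aS (negbTE bS).
  case: (a \in U); case: (b \in U); case: (z \in U) => //= _ -> ->;
    case: (z \in S) => //.
  - by move/(_ isT isT isT).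
  - by move=> _ _ _ /(_ isT isT isT).
  - by move=> _ /(_ isT isT isT).
  - by move=> _ _ /(_ isT isT isT).
by rewrite !inS; do 3 case: (_ \in U).
Qed.

(** Deleting one crossing edge from a 2-edge-connected part leaves it connected,
    so there is a second one. *)
Lemma edge_connected2_cross_twice U S e :
  subgraph_edge_connected 2 U (induced_edges U) -> e \in induced_edges U ->
  e \in cut S ->
  exists2 f, f \in induced_edges U & (f \in cut S) && (f != e).
Proof.
move=> /forallP/(_ [set e]); rewrite cards1 /= => conU eU.
case/cut_ends=> u [v [euv uS vS]].
have /andP[uU vU] : (u \in U) && (v \in U).
  by rewrite -!sub1set -subUset -euv; rewrite inE in eU.
have [f] := subgraph_connected_cross conU uU vU uS vS.
by rewrite !inE => /andP[fe fU] fS; exists f; rewrite ?inE ?fU // fS fe.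
Qed.

Lemma subgraph_edge_connected_connected k W F :
  0 < k -> subgraph_edge_connected k W F -> subgraph_connected W F.
Proof. by move=> k0 /forallP/(_ set0); rewrite cards0 k0 setD0. Qed.

(** A set [S] that is not 2-edge-connected falls into [S1] and [S2] with at most
    one edge between them.  An edge common to [cut S1] and [cut S2] is such an
    edge, since [S1] and [S2] are disjoint, and [cut S] is the symmetric
    difference of the two cuts.  3-edge-connectedness bounds both cuts below by
    three, which is what makes the new cut strictly smaller. *)
Lemma strict_min_cut_split d (T : orderType d) (x : edge G -> T) S :
  edge_connected 3 G -> S != set0 -> ~: S != set0 ->
  has_strict_min x (cut S) ->
  ~~ subgraph_edge_connected 2 S (induced_edges S) ->
  exists S', [/\ S' != set0, ~: S' != set0, has_strict_min x (cut S') &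
    #|cut S'| < #|cut S|].
Proof.
move=> conG S0 SC0 minS /forall_inPn[F]; rewrite unfold_in => F2 notcon.
have [S1 [sS1 S10 S20 sep]] := not_subgraph_connected_separation S0 notcon.
have S1S z : (z \in S1) ==> (z \in S) by apply/implyP/(subsetP sS1).
set S2 := S :\: S1 in S20.
have properC S' : S' \subset S -> ~: S' != set0.
  move=> sub; apply: contraNneq SC0 => S'0; rewrite -subset0 -S'0.
  by rewrite setCS.
have sS2 : S2 \subset S by apply: subsetDl.
have cutS : cut S = (cut S1 :\: cut S2) :|: (cut S2 :\: cut S1).
  apply/setP => e; have [u [v euv]] := endsP e.
  rewrite in_setU !in_setD !(in_cut _ euv) !in_setD.
  by move: (S1S u) (S1S v); do 4 case: (_ \in _).
have capF : cut S1 :&: cut S2 \subset F.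
  apply/subsetP => e /setIP[e1 e2]; have [u [v euv]] := endsP e.
  have eS : ends e \subset S.
    move: e1 e2; rewrite euv subUset !sub1set !(in_cut _ euv) !in_setD.
    by move: (S1S u) (S1S v); do 4 case: (_ \in _).
  apply/negPn/negP => eF; move: e1; apply/negP/sep => //.
  by rewrite !inE eF.
have c1 := edge_connected_cut conG S10 (properC _ sS1).
have c2 := edge_connected_cut conG S20 (properC _ sS2).
have cF : #|cut S1 :&: cut S2| <= 1.
  by apply: leq_trans (subset_leq_card capF) _.
move: minS; rewrite cutS => /(has_strict_min_symdiff c1 c2 cF)[D].
rewrite !inE => /orP[]/eqP-> /andP[minD ltD].
  by exists S1; rewrite properC.
by exists S2; rewrite properC.
Qed.

End Cuts.

(** A smallest cut with a strict minimum cannot be made smaller by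
    [strict_min_cut_split], applied to either side, so both of its sides are
    2-edge-connected. *)
Lemma strict_min_cut_reduction (G : graph) d (T : orderType d)
    (x : edge G -> T) (C : {set edge G}) :
  edge_connected 3 G -> minimal_edge_cut C -> has_strict_min x C ->
  exists2 D, D \in cuts_into_2_edge_connected G & has_strict_min x D.
Proof.
move=> conG minC strictC.
have conG1 := edge_connected_connected (ltn0Sn 2) conG.
pose P S := [&& S != set0, ~: S != set0 & has_strict_min x (cut S)].
have [S0 PS0] : exists S, P S.
  have [S defC] := minimal_edge_cutP conG1 minC; exists S.
  rewrite /P -defC strictC andbT.
  have /has_strict_minP[e] := strictC.
  rewrite defC => /cut_ends[u [v [_ uS vS]]] _.
  by apply/andP; split; apply/set0Pn; [exists u | exists v; rewrite inE].
case: (arg_minnP (fun S => #|cut S|) PS0) => S.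
case/and3P=> S_neq0 SC_neq0 strictS minS.
have con2 W : W != set0 -> ~: W != set0 -> cut W = cut S ->
    subgraph_edge_connected 2 W (induced_edges W).
  move=> W0 WC0 cutW; apply/negPn/negP => notcon.
  have strictW : has_strict_min x (cut W) by rewrite cutW.
  have [W' [W'0 W'C0 strictW']] :=
    strict_min_cut_split conG W0 WC0 strictW notcon.
  by rewrite cutW ltnNge minS // /P W'0 W'C0.
have conS := con2 S S_neq0 SC_neq0 erefl.
have conSC : subgraph_edge_connected 2 (~: S) (induced_edges (~: S)).
  by apply: con2; rewrite ?cutC ?setCK.
have S1 := subgraph_edge_connected_connected (ltn0Sn 1) conS.
have SC1 := subgraph_edge_connected_connected (ltn0Sn 1) conSC.
exists (cut S) => //; rewrite inE minimal_edge_cut_of_connected //=.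
apply/existsP; exists S; apply/existsP; exists (~: S).
by rewrite conS conSC /splits eqxx S1 SC1 eqxx.
Qed.

(** * Tropical bases *)

Local Open Scope ereal_scope.

Lemma has_strict_min_not_attained_twice (R : realType) (E : finType)
    (C : {set E}) (x : E -> \bar R) :
  has_strict_min x C -> ~ min_attained_twice C x.
Proof.
case/has_strict_minP=> e eC min_e [i [j [iC jC ij xij min_i]]].
have [ie|ie] := eqVneq i e.
  have := min_e j jC; rewrite -ie eq_sym ij => /(_ isT).
  by rewrite xij ltxx.
by have := min_e i iC ie; rewrite ltNge min_i.
Qed.

Lemma min_attained_twice_of_not_strict (R : realType) (E : finType)
    (C : {set E}) (x : E -> \bar R) :
  C != set0 -> ~~ has_strict_min x C -> min_attained_twice C x.
Proof.
case/set0Pn=> e0 e0C notstrict.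
case: (arg_minP x e0C) => i iC min_i; exists i.
apply: contrapT => notj; case/negP: notstrict.
apply/has_strict_minP; exists i => // k kC ki.
rewrite lt_neqAle min_i // andbT; apply/negP => /eqP xik; apply: notj.
by exists k; split; rewrite // eq_sym.
Qed.

Definition tropical_indicator (R : realType) (E : finType) (D : {set E}) :
  {ffun E -> \bar R} := [ffun e => if e \in D then 1 else 0 : \bar R].

Section TropicalBases.
Variables (R : realType) (G : graph) (hG : edge_connected 3 G).
Let M := cographic_matroid (edge_connected_connected (ltn0Sn 2) hG).

Lemma cuts_into_2_edge_connected_tropical_basis :
  tropical_basis R M (cuts_into_2_edge_connected G).
Proof.
split; first by apply/subsetP => C; rewrite !inE => /andP[].
apply/seteqP; split=> p pB C CB; last first.
  by apply: pB; move: CB; rewrite /= !inE => /andP[].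
have minC : minimal_edge_cut C by move: CB; rewrite /= inE.
apply: min_attained_twice_of_not_strict.
  by apply: contraNneq (circuit_neq0 M) => <-.
apply/negP => /(strict_min_cut_reduction hG minC)[D /pB twiceD].
by move/has_strict_min_not_attained_twice; apply.
Qed.

(** The indicator of [C] minus one edge [e0] is a point at which [C] is the only
    bond with a strict minimum: any other bond contains an edge of one of the
    two sides, hence two such edges, where the indicator takes its least value
    0.  A tropical basis without [C] would admit this point. *)
Lemma cut_into_2_edge_connected_essential (B : {set {set edge G}})
    (C : {set edge G}) :
  tropical_basis R M B -> C \in cuts_into_2_edge_connected G -> C \in B.
Proof.
case=> /subsetP sBM eqB; rewrite inE => /andP[minC].
case/existsP=> U /existsP[V /andP[/and4P[/eqP-> _ _ /eqP defC]]].
case/andP=> conU conV.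
apply/negPn/negP => CB.
have [e0 e0C] : exists e, e \in C.
  apply/set0Pn; apply: contraTneq minC => ->.
  by have := circuit_neq0 M; rewrite inE.
pose x := tropical_indicator R (C :\ e0).
have tropical_x : [forall e, x e != -oo] && [exists e, x e != +oo].
  apply/andP; split; first by apply/forallP => e; rewrite ffunE; case: ifP.
  by apply/existsP; exists e0; rewrite ffunE; case: ifP.
pose y : tropical_vector R (edge G) := exist _ x tropical_x.
pose p := (\pi_(tropical_projective_space R (edge G)) y)%qT.
have xC0 e : e \notin C -> x e = 0.
  by rewrite ffunE !inE => /negbTE->; rewrite andbF.
have x_ge0 e : (0 : \bar R) <= x e by rewrite ffunE; case: ifP.
have pC : ~ tropical_hyperplane C p.
  move/tropical_hyperplane_pi; apply: has_strict_min_not_attained_twice.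
  apply/has_strict_minP; exists e0 => // k kC ke.
  by rewrite !ffunE !inE eqxx ke kC /= lte01.
apply: pC; suff pB : tropical_prevariety B p.
  by move: pB; rewrite eqB => /(_ C); apply; rewrite /= inE.
move=> D /= DB; apply/tropical_hyperplane_pi.
have minD : minimal_edge_cut D by have := sBM D DB; rewrite inE.
have [S defD] :=
  minimal_edge_cutP (edge_connected_connected (ltn0Sn 2) hG) minD.
have twice W e : W = U \/ W = (~: U)%SET ->
    subgraph_edge_connected 2 W (induced_edges W) ->
    e \in induced_edges W -> e \in D -> min_attained_twice D x.
  move=> WU conW eW eD.
  have WC f : f \in induced_edges W -> x f = 0.
    move=> fW; apply: xC0; rewrite defC.
    by case: WU fW => -> /induced_edges_cut; rewrite ?cutC.
  rewrite defD in eD.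
  have [f fW /andP[fS fe]] := edge_connected2_cross_twice conW eW eD.
  exists e, f; rewrite defD; split; rewrite ?WC // eq_sym //.
have [e eD eC] : exists2 e, e \in D & e \notin C.
  apply/subsetPn; apply: contraNN CB => /(circuit_incomparable (m := M)) <- //;
    by rewrite inE.
have [||] := edge_trichotomy U e.
- by rewrite -defC (negbTE eC).
- by move/(twice U); apply; rewrite //; left.
- by move/(twice (~: U)%SET); apply; rewrite //; right.
Qed.

End TropicalBases.

Theorem theorem9 (R : realType) (G : graph) (hG : edge_connected 3 G) :
  let M := cographic_matroid (edge_connected_connected (ltn0Sn 2) hG) in
  unique (minimal_tropical_basis R M) (cuts_into_2_edge_connected G).
Proof.
move=> M; have basis := cuts_into_2_edge_connected_tropical_basis R hG.
have least B : tropical_basis R M B -> cuts_into_2_edge_connected G \subset B.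
  move=> basisB; apply/subsetP => C.
  exact: (cut_into_2_edge_connected_essential basisB).
split; last by move=> B [basisB minB]; apply: minB; last exact: least.
split=> // B basisB sub; apply/eqP; rewrite eqEsubset sub; exact: least.
Qed.
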